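(* Let $G=(V,E)$ be a hypergraph with $G=\mathrm{cl}(G)$, and let $C=e_1,e_2,e_3,e_1$ be an $\alpha$-cycle of $G$ (of length three). Suppose that $$e_1\setminus(e_2\cup e_3)=\emptyset,\quad e_2\setminus(e_1\cup e_3)=\emptyset,\quad e_3\setminus(e_1\cup e_2)=\emptyset.$$ Then all switchings of the following inequalities are valid for the multilinear polytope $\mathrm{MP}(G)$: \begin{align*} & z_{e_1}+z_{e_2}\le z_{e_1\cap e_2}+z_{e_3},\\ & z_{e_1}+z_{e_3}\le z_{e_1\cap e_3}+z_{e_2},\\ & z_{e_2}+z_{e_3}\le z_{e_2\cap e_3}+z_{e_1},\\ & z_{e_1\cap e_2}+z_{e_1\cap e_3}+z_{e_2\cap e_3}-z_{e_1}-z_{e_2}-z_{e_3}\le z_{e_1\cap e_2\cap e_3}, \end{align*} where $z_\emptyset:=1$ (and $z_{\{v\}}:=z_v$). Moreover, all switchings of these inequalities define facets of $\mathrm{MP}(G_C)$, where $G_C$ is the support hypergraph of $C$.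
   Context: A hypergraph $G=(V,E)$ consists of a finite set $V$ of nodes and a set $E$ of subsets of $V$ of cardinality at least two, called edges. Its completion is $\mathrm{cl}(G)=(V,\mathrm{cl}(E))$ with $\mathrm{cl}(E):=\{f:|f|\ge2,\ f\subseteq e\text{ for some }e\in E\}$. The multilinear polytope is $\mathrm{MP}(G):=\mathrm{conv}\{z\in\{0,1\}^{V\cup E}: z_e=\prod_{v\in e}z_v\ \forall e\in E\}$. An $\alpha$-cycle of $G$ of length $\ell\ge3$ is a sequence $C=e_1,\dots,e_\ell,e_{\ell+1}$ of edges with $e_{\ell+1}=e_1$ such that, with $s_i:=e_i\cap e_{i+1}$ for $i\in\{1,\dots,\ell\}$: (1) $e_i\setminus e_j\ne\emptyset$ for all $i\neq j\in\{1,\dots,\ell\}$; (2) $(s_{i-1}\cup s_i\cup s_{i+1})\setminus e\neq\emptyset$ for all $i\in\{1,\dots,\ell\}$ and all $e\in E$, with indices modulo $\ell$. The support hypergraph of $C=e_1,e_2,e_3,e_1$ is $G_C=(V_C,E_C)$ with $V_C:=e_1\cup e_2\cup e_3$ and $E_C:=\{e: |e|\ge2,\ e\subseteq e_i\text{ for some }i\in\{1,2,3\}\}$. Switching: for a hypergraph $G=(V,E)$ with $G=\mathrm{cl}(G)$ and $U\subseteq V$, let $\phi_U$ be the affine map of $\mathbb{R}^{V\cup E}$ given by $\phi_U(z_v)=1-z_v$ if $v\in U$, $\phi_U(z_v)=z_v$ if $v\in V\setminus U$, and for $e\in E$ $$\phi_U(z_e)=\sum_{W\subseteq e\cap U,\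 |W|\text{ even}}z_{(e\setminus U)\cup W}-\sum_{W\subseteq e\cap U,\ |W|\text{ odd}}z_{(e\setminus U)\cup W},$$ with $z_\emptyset:=1$ and $z_{\{v\}}:=z_v$. The $U$-switching of a linear inequality $az\le\beta$ is its image under $\phi_U$, i.e. the inequality obtained by replacing each variable $z_p$ by $\phi_U(z_p)$. ''All switchings'' means the $U$-switchings for all $U\subseteq V$ (for statements about $G_C$, all $U\subseteq V_C$). *)

(* Defs.v *)
From HB Require Import structures.
From mathcomp Require Import all_boot all_order all_algebra.
Set Implicit Arguments.
Unset Strict Implicit.
Unset Printing Implicit Defensive.
Import Order.TTheory GRing.Theory Num.Theory.
Local Open Scope ring_scope.

(* The node set is a subset of an ambient finite type, so that a hypergraph
   and its support hypergraphs live over the same type. *)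
Record hypergraph (T : finType) := Hypergraph {
  nodes : {set T};
  edges : {set {set T}};
  edgesP : [forall e in edges, (e \subset nodes) && (1 < #|e|)%N]
}.

Section Hypergraphs.
Variable T : finType.
Implicit Types (G : hypergraph T) (e f : {set T}).

Definition cl_edges G : {set {set T}} :=
  [set f : {set T} | (1 < #|f|)%N & [exists e in edges G, f \subset e]].

Fact cl_edgesP G :
  [forall f in cl_edges G, (f \subset nodes G) && (1 < #|f|)%N].
Proof.
apply/forall_inP => f; rewrite inE => /andP[-> /exists_inP[e eE fe]].
by have /forall_inP/(_ e eE)/andP[/(subset_trans fe)-> _] := edgesP G.
Qed.

Definition cl G : hypergraph T := Hypergraph (cl_edgesP G).

(* The closing edge C_(l+1) = C_1 is implicit: ordS and ord_pred are the cyclic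
   successor and predecessor on 'I_l. *)
Definition alpha_cycle G (l : nat) (C : l.-tuple {set T}) : Prop :=
  let s (i : 'I_l) := tnth C i :&: tnth C (ordS i) in
  [/\ (2 < l)%N,
      forall i, tnth C i \in edges G,
      forall i j, i != j -> tnth C i :\: tnth C j != set0
    & forall i e, e \in edges G ->
        (s (ord_pred i) :|: s i :|: s (ordS i)) :\: e != set0].

Definition support_edges e1 e2 e3 : {set {set T}} :=
  [set e : {set T} | (1 < #|e|)%N & [|| e \subset e1, e \subset e2 | e \subset e3]].

Fact support_edgesP e1 e2 e3 :
  [forall e in support_edges e1 e2 e3,
    (e \subset e1 :|: e2 :|: e3) && (1 < #|e|)%N].
Proof.
apply/forall_inP => e; rewrite inE => /andP[-> sub]; rewrite andbT.
case/or3P: sub => /subset_trans; apply.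
- by rewrite -setUA subsetUl.
- by rewrite setUAC subsetUr.
- by rewrite subsetUr.
Qed.

Definition support_hypergraph e1 e2 e3 : hypergraph T :=
  Hypergraph (support_edgesP e1 e2 e3).

(* The index set V u E; a node v is represented by the singleton [set v], which
   is never an edge. *)
Definition coord_sets G : {set {set T}} :=
  [set [set v] | v in nodes G] :|: edges G.

Definition coord G := {p : {set T} | p \in coord_sets G}.

End Hypergraphs.

Section Polyhedra.
Variables (R : realFieldType) (V : lmodType R).
Implicit Type S : V -> Prop.

Definition conv S (y : V) : Prop :=
  exists (n : nat) (x : 'I_n -> V) (c : 'I_n -> R),
    [/\ forall i, S (x i), forall i, 0 <= c i,
        \sum_i c i = 1 & y = \sum_i c i *: x i].

Definition affinely_independent (n : nat) (x : 'I_n -> V) : Prop :=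
  forall c : 'I_n -> R,
    \sum_i c i = 0 -> \sum_i c i *: x i = 0 -> forall i, c i = 0.

Definition has_dim S (d : nat) : Prop :=
  (exists x : 'I_d.+1 -> V, (forall i, S (x i)) /\ affinely_independent x) /\
  (forall (n : nat) (x : 'I_n -> V),
     (forall i, S (x i)) -> affinely_independent x -> (n <= d.+1)%N).

End Polyhedra.

Section Multilinear.
Variables (R : realFieldType) (T : finType).
Implicit Type G : hypergraph T.

Definition point G := {ffun coord G -> R^o}.

(* (a, b) stands for the affine form z |-> \sum_p a_p z_p + b. *)
Definition aform G := ({ffun coord G -> R^o} * R^o)%type.

Definition eval G (f : aform G) (z : point G) : R :=
  \sum_p f.1 p * z p + f.2.

(* z_p, with z_set0 := 1; the value 0 at the sets p that are neither empty nor
   coordinates is junk. *)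
Definition zvar G (p : {set T}) : aform G :=
  ([ffun q => (val q == p)%:R], (p == set0)%:R).

Definition multilinear_point G (z : point G) : Prop :=
  (forall p, z p = 0 \/ z p = 1) /\
  (forall e, e \in edges G ->
     eval (zvar G e) z = \prod_(v in e) eval (zvar G [set v]) z).

Definition MP G : point G -> Prop := conv (@multilinear_point G).

(* The inequality (f, g) is f <= g. *)
Definition ineq G := (aform G * aform G)%type.

Definition valid G (P : point G -> Prop) (I : ineq G) : Prop :=
  forall z, P z -> eval I.1 z <= eval I.2 z.

Definition face G (P : point G -> Prop) (I : ineq G) (z : point G) : Prop :=
  P z /\ eval I.1 z = eval I.2 z.

Definition defines_facet G (P : point G -> Prop) (I : ineq G) : Prop :=
  valid P I /\ exists d : nat, has_dim P d.+1 /\ has_dim (face P I) d.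

(* At a node v, i.e. p = [set v], the alternating sum is 1 - z_v or z_v: see
   phi_node_in and phi_node_out. *)
Definition phi G (U : {set T}) (p : coord G) : aform G :=
  \sum_(W : {set T} | (W \subset val p :&: U) && ~~ odd #|W|)
     zvar G ((val p :\: U) :|: W)
  - \sum_(W : {set T} | (W \subset val p :&: U) && odd #|W|)
     zvar G ((val p :\: U) :|: W).

Definition subst_phi G (U : {set T}) (f : aform G) : aform G :=
  \sum_p f.1 p *: phi U p + (0, f.2).

Definition switching G (U : {set T}) (I : ineq G) : ineq G :=
  (subst_phi U I.1, subst_phi U I.2).

Definition cycle3_ineqs G (e1 e2 e3 : {set T}) : seq (ineq G) :=
  let z := zvar G in
  [:: (z e1 + z e2, z (e1 :&: e2) + z e3);
      (z e1 + z e3, z (e1 :&: e3) + z e2);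
      (z e2 + z e3, z (e2 :&: e3) + z e1);
      (z (e1 :&: e2) + z (e1 :&: e3) + z (e2 :&: e3) - z e1 - z e2 - z e3,
       z (e1 :&: e2 :&: e3))].

Lemma evalD G (f g : aform G) z : eval (f + g) z = eval f z + eval g z.
Proof.
rewrite /eval /= addrACA -big_split /=; congr (_ + _).
by apply: eq_bigr => p _; rewrite ffunE mulrDl.
Qed.

Lemma evalZ G a (f : aform G) z : eval (a *: f) z = a * eval f z.
Proof.
rewrite /eval /= mulrDr big_distrr /=; congr (_ + _).
by apply: eq_bigr => p _; rewrite ffunE mulrA.
Qed.

Lemma eval_subst_phi G U (f : aform G) z :
  eval (subst_phi U f) z = eval f [ffun p => eval (phi U p) z].
Proof.
have eval0 : eval (0 : aform G) z = 0.
  by rewrite -(scale0r (0 : aform G)) evalZ mul0r.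
rewrite /subst_phi evalD; congr (_ + _).
  rewrite (big_morph (fun f => eval f z) (fun f g => evalD f g z) eval0).
  by apply: eq_bigr => p _; rewrite evalZ ffunE.
by rewrite /eval /= big1 ?add0r // => p _; rewrite ffunE mul0r.
Qed.

Lemma phi_node_in G (U : {set T}) (v : T) (p : coord G) :
  val p = [set v] -> v \in U -> phi U p = zvar G set0 - zvar G [set v].
Proof.
rewrite /phi => -> vU.
have -> : [set v] :&: U = [set v] by apply/setIidPl; rewrite sub1set.
have -> : [set v] :\: U = set0 by apply/eqP; rewrite setD_eq0 sub1set.
congr (_ - _).
- rewrite (big_pred1 set0) ?setU0 // => W /=; rewrite subset1.
  by case: eqP => [->|_] /=; [rewrite cards1 -cards_eq0 cards1|
     case: eqP => // ->; rewrite cards0].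
- rewrite (big_pred1 [set v]) ?set0U // => W /=; rewrite subset1.
  by case: eqP => [->|_] /=; [rewrite cards1|
     case: eqP => // ->; rewrite cards0].
Qed.

Lemma phi_node_out G (U : {set T}) (v : T) (p : coord G) :
  val p = [set v] -> v \notin U -> phi U p = zvar G [set v].
Proof.
rewrite /phi => -> vU.
have /eqP -> : [set v] :&: U == set0.
  by rewrite setI_eq0 disjoints1.
have -> : [set v] :\: U = [set v].
  by apply/setDidPl; rewrite disjoints1.
rewrite (big_pred1 set0) => [|W /=]; last first.
  by rewrite subset0; case: eqP => // ->; rewrite cards0.
rewrite big_pred0 ?subr0 ?setU0 // => W.
by rewrite subset0; case: eqP => // ->; rewrite cards0.
Qed.

End Multilinear.

Arguments MP R {T} G z.
Arguments cycle3_ineqs R {T} G e1 e2 e3.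

(* Main.v *)
(* The vertices of MP(G) are the points z^S with z^S_p = [p <= S], S a set of
   nodes, and phi_U maps z^S to z^(S xor U).  So validity is a check on sets, and
   an inequality defines a facet as soon as some S0 is not tight and every affine
   form vanishing on the tight vertices and on z^S0 vanishes on all vertices; this
   criterion is invariant under switching.  An affine form evaluates at z^S to
   F(S) = \sum_(p <= S) c_p, so the criterion is a Moebius-type statement: if
   F(E u Q') = 0 for all Q' <= Q, then the c_p with p \ E = Q sum to 0.  With E
   empty this kills most c_p; with E one of the edges, or one of their pairwise
   intersections, the fibre has a single unknown term and the rest follow.
   S0 is e1 /\ e2 for the first three inequalities, up to renaming, and
   e1 /\ e2 /\ e3 for the last. *)
From mathcomp Require Import all_boot all_order all_algebra.
Require Import Defs.
Set Implicit Arguments.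
Unset Strict Implicit.
Unset Printing Implicit Defensive.
Import Order.TTheory GRing.Theory Num.Theory.
Local Open Scope ring_scope.

(** * Moebius inversion over subsets *)

(** Strong induction on the size of [Q]: the subsets of [E :|: Q] are grouped by their trace outside
    [E], and the groups of the proper subsets of [Q] already sum to zero. *)
Lemma fiber_sum_eq0 (R : nmodType) (T : finType) (c : {set T} -> R)
    (E Q : {set T}) :
  (forall Q' : {set T}, Q' \subset Q -> \sum_(p : {set T} | p \subset E :|: Q') c p = 0) ->
  \sum_(p : {set T} | p :\: E == Q) c p = 0.
Proof.
have [n] := ubnP #|Q|; elim: n Q => // n IH Q leQn F0.
have := F0 Q (subxx Q).
rewrite (eq_bigl (fun p : {set T} => p :\: E \subset Q)) => [|p]; last by rewrite subDset.
rewrite (partition_big (fun p : {set T} => p :\: E) (fun Q' : {set T} => Q' \subset Q)) //=.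
rewrite (bigD1 Q) //= [X in _ + X]big1 ?addr0 => [F_Q|Q' /andP[Q'Q neqQQ]].
  rewrite -[RHS]F_Q; apply: eq_bigl => p.
  by case: eqP => [->|]; rewrite ?subxx ?andbF.
rewrite -[RHS](IH Q'); first by apply: eq_bigl => p; case: eqP => [->|]; rewrite ?Q'Q ?andbF.
  by rewrite -ltnS; apply: leq_trans leQn; rewrite ltnS proper_card // properEneq neqQQ.
by move=> Q'' /subset_trans/(_ Q'Q); apply: F0.
Qed.

Lemma coef_eq0 (R : nmodType) (T : finType) (c : {set T} -> R) (p : {set T}) :
  (forall q : {set T}, q \subset p -> \sum_(r : {set T} | r \subset q) c r = 0) -> c p = 0.
Proof.
move=> F0; rewrite -[RHS](@fiber_sum_eq0 _ _ c set0 p) => [|q qp].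
  by rewrite (big_pred1 p) // => q; rewrite setD0.
by rewrite set0U F0.
Qed.

Lemma sole_term_eq0 (R : nmodType) (I : finType) (P : pred I) (c : I -> R) (i : I) :
  P i -> \sum_(j | P j) c j = 0 -> (forall j, P j -> c j != 0 -> j = i) -> c i = 0.
Proof.
move=> Pi sum0 sole; rewrite -[RHS]sum0 (bigD1 i) //= big1 ?addr0 // => j /andP[Pj ji].
by apply/eqP; apply: contraNT ji => /(sole j Pj) ->.
Qed.

(** * Triples of edges covering one another *)

Definition triangle (T : finType) (e1 e2 e3 : {set T}) : bool :=
  [&& e1 \subset e2 :|: e3, e2 \subset e1 :|: e3, e3 \subset e1 :|: e2,
      ~~ (e1 \subset e2), ~~ (e1 \subset e3), ~~ (e2 \subset e1),
      ~~ (e2 \subset e3), ~~ (e3 \subset e1) & ~~ (e3 \subset e2)].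

Lemma triangle_swap (T : finType) (e1 e2 e3 : {set T}) :
  triangle e1 e2 e3 -> triangle e2 e1 e3.
Proof. by rewrite /triangle [e2 :|: e1]setUC; case/and5P=> -> -> -> -> /and5P[-> -> -> -> ->]. Qed.

Lemma triangle_rot (T : finType) (e1 e2 e3 : {set T}) :
  triangle e1 e2 e3 -> triangle e2 e3 e1.
Proof.
rewrite /triangle [e3 :|: e1]setUC [e2 :|: e1]setUC.
by case/and5P=> -> -> -> -> /and5P[-> -> -> -> ->].
Qed.

Lemma subset_at (T : finType) (A B : {set T}) (x : T) :
  A \subset B -> (x \in A) ==> (x \in B).
Proof. by move=> /subsetP AB; apply/implyP/AB. Qed.

(* Set-theoretic goals are decided by evaluating every hypothesis at one generic point. *)
Ltac at_point x :=
  repeat match goal with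
  | H : is_true (_ \subset _) |- _ => move/(subset_at x): H
  | H : _ = _ |- _ => move/setP/(_ x): H
  end; rewrite !inE; repeat case: (x \in _) => //=.
Ltac pointwise :=
  let x := fresh "x" in
  (apply/eqP; rewrite eqEsubset; apply/andP; split; apply/subsetP => x; apply/implyP; at_point x)
  || (apply/subsetP => x; apply/implyP; at_point x).

(** * Tight sets of the first three inequalities *)

(** Fibres outside [e1] isolate each [p] strictly between [e1 :&: e2] and [e2]. A supported set of
    the same fibre cannot lie in [e1], cannot lie in [e3] without giving [e1 \subset e3] or
    [e2 \subset p], and inside [e2] it equals [p]. Then [e2] is the last term of its own sum. *)
Lemma pair_tight_span_half (R : nmodType) (T : finType) (e1 e2 e3 : {set T}) (c : {set T} -> R) :
  triangle e1 e2 e3 ->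
  (forall p : {set T}, c p != 0 -> [|| p \subset e1, p \subset e2 | p \subset e3]) ->
  (forall p : {set T}, c p != 0 -> p != e3 -> e1 :&: e2 \subset p) ->
  c (e1 :&: e2) = 0 ->
  (forall S : {set T}, (e1 \subset S) || (e2 \subset S) -> \sum_(p : {set T} | p \subset S) c p = 0) ->
  forall p : {set T}, p \subset e2 -> c p = 0.
Proof.
case/and5P=> s1 s2 s3 n12 /and5P[n13 n21 n23 n31 n32] supp low c12 F0.
suff lt2 (p : {set T}) : p \subset e2 -> p != e2 -> c p = 0.
  move=> p pe2; case: (eqVneq p e2) => [->|]; last exact: lt2.
  apply: (@sole_term_eq0 _ _ (fun q : {set T} => q \subset e2)) => [//||q qe2].
    by rewrite F0 ?subxx ?orbT.
  by apply: contraNeq => /(lt2 q qe2)->.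
move=> p2 ne2; apply/eqP; apply/idPn => cp.
have ne3: p != e3 by apply: contraNneq n32 => <-.
have lp := low p cp ne3.
have n2p: ~~ (e2 \subset p).
  by apply: contraNN ne2 => ?; rewrite eqEsubset p2.
have n1 : ~~ (p \subset e1).
  apply: contraNN cp => p1.
  by rewrite (_ : p = e1 :&: e2) ?c12 //; pointwise.
suff : c p = 0 by move/eqP: cp.
apply: (@sole_term_eq0 _ _ (fun q : {set T} => q :\: e1 == p :\: e1)) => //.
  by apply: fiber_sum_eq0 => Q _; rewrite F0 ?subsetUl.
move=> q /eqP qp cq.
(* By the covering conditions [e2] and [e3] have the same trace outside [e1], so [q = e3] would put
   all of [e2] into [p]. *)
have qe3 : q != e3.
  by apply: contraNneq n2p => q3; subst q; pointwise.
have lq := low q cq qe3.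
case/or3P: (supp q cq) => sq.
- by case/negP: n1; pointwise.
- by pointwise.
- by case/negP: n13; pointwise.
Qed.

Lemma pair_tight_span (R : nmodType) (T : finType) (e1 e2 e3 : {set T}) (c : {set T} -> R) :
  triangle e1 e2 e3 ->
  (forall p : {set T}, c p != 0 -> [|| p \subset e1, p \subset e2 | p \subset e3]) ->
  (forall S : {set T}, ~~ (e1 :&: e2 \subset S) -> ~~ (e3 \subset S) ->
     \sum_(p : {set T} | p \subset S) c p = 0) ->
  (forall S : {set T}, (e1 \subset S) || (e2 \subset S) ->
     \sum_(p : {set T} | p \subset S) c p = 0) ->
  \sum_(p : {set T} | p \subset e1 :&: e2) c p = 0 ->
  forall p : {set T}, c p = 0.
Proof.
move=> tri supp Fa Fb Fc.
have /and5P[s1 s2 s3 n12 /and5P[n13 n21 n23 n31 n32]] := tri.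
(* A supported [p] lies in an edge, so it contains [e3] only if it equals [e3]; otherwise, if it
   lacks [e1 :&: e2], all its subsets are tight and inversion kills its coefficient. *)
have low (p : {set T}) : c p != 0 -> p != e3 -> e1 :&: e2 \subset p.
  move=> cp ne3; apply/idPn => n12p; case/eqP: (cp); apply: coef_eq0 => q qp.
  apply: Fa; first by apply: contraNN n12p => /subset_trans; apply.
  apply/negP => /subset_trans/(_ qp) e3p.
  case/or3P: (supp p cp) => sp.
  - by rewrite (subset_trans e3p sp) in n31.
  - by rewrite (subset_trans e3p sp) in n32.
  - by rewrite eqEsubset sp e3p in ne3.
have n12_3 : ~~ (e1 :&: e2 \subset e3).
  by apply: contraNN n13 => s; pointwise.
have c12 : c (e1 :&: e2) = 0.
  apply: (@sole_term_eq0 _ _ (fun q : {set T} => q \subset e1 :&: e2)) => //.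
  move=> q q12 cq; apply/eqP; rewrite eqEsubset q12 low //.
  by apply: contraNneq n31 => <-; rewrite (subset_trans q12) ?subsetIl.
have z2 : forall p : {set T}, p \subset e2 -> c p = 0.
  exact: (pair_tight_span_half tri supp low c12 Fb).
have z1 : forall p : {set T}, p \subset e1 -> c p = 0.
  apply: (pair_tight_span_half (triangle_swap tri)) => [p|p||S]; rewrite 1?[e2 :&: e1]setIC //.
  - by move/supp; rewrite orbCA.
  - exact: low.
  - by rewrite orbC; apply: Fb.
have ne3 (p : {set T}) : c p != 0 -> p = e3.
  move=> cp; apply/eqP/idPn => ne3; case/eqP: (cp).
  case/or3P: (supp p cp) => sp; [exact: z1|exact: z2|].
  by rewrite (subset_trans (low p cp ne3) sp) in n12_3.
have c3 : c e3 = 0.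
  (* At [setT] the sum runs over all sets, and only [e3] can still contribute. *)
  apply: (@sole_term_eq0 _ _ (fun q : {set T} => q \subset setT)); rewrite ?subsetT //.
    by rewrite Fb ?subsetT.
  by move=> q _; apply: ne3.
by move=> p; apply/eqP/idPn => cp; have pe3 := ne3 p cp; rewrite pe3 c3 eqxx in cp.
Qed.

(** * Tight sets of the fourth inequality *)

(** The situation once only sets strictly above the triple intersection carry coefficients. It is
    stable under permuting the edges, so one edge or one intersection is treated at a time. *)
Definition triple_tight (R : nmodType) (T : finType) (e1 e2 e3 : {set T}) (c : {set T} -> R) :=
  [/\ triangle e1 e2 e3,
      forall p : {set T}, c p != 0 -> [|| p \subset e1, p \subset e2 | p \subset e3],
      forall p : {set T}, c p != 0 -> e1 :&: e2 :&: e3 \proper p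
    & forall S : {set T}, ~~ (e1 :|: e2 :|: e3 \subset S) ->
        [|| e1 :&: e2 \subset S, e1 :&: e3 \subset S | e2 :&: e3 \subset S] ->
        \sum_(p : {set T} | p \subset S) c p = 0].

Lemma triple_tight_swap (R : nmodType) (T : finType) (e1 e2 e3 : {set T}) (c : {set T} -> R) :
  triple_tight e1 e2 e3 c -> triple_tight e2 e1 e3 c.
Proof.
case=> tri supp low F0; split.
- exact: triangle_swap.
- by move=> p /supp; rewrite orbCA.
- by rewrite [e2 :&: e1]setIC.
- move=> S; rewrite [e2 :|: e1]setUC [e2 :&: e1]setIC => nS.
  by rewrite [X in _ || X]orbC; apply: F0.
Qed.

Lemma triple_tight_rot (R : nmodType) (T : finType) (e1 e2 e3 : {set T}) (c : {set T} -> R) :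
  triple_tight e1 e2 e3 c -> triple_tight e2 e3 e1 c.
Proof.
case=> tri supp low F0; split.
- exact: triangle_rot.
- by move=> p /supp; rewrite orbC -orbA.
- by rewrite setIC setIA.
- move=> S; rewrite [_ :|: e1]setUC setUA [e2 :&: e1]setIC [e3 :&: e1]setIC => nS.
  by rewrite orbC -orbA; apply: F0.
Qed.

(** Any other [p] is alone in its fibre outside [e1 :&: e2]: a member inside [e1] or [e2] would pull
    [p] in as well, and one inside [e3] meets [e1 :&: e2] in the triple intersection, just as [p]
    does. *)
Lemma triple_tight_mixed (R : nmodType) (T : finType) (e1 e2 e3 : {set T}) (c : {set T} -> R) :
  triple_tight e1 e2 e3 c ->
  forall p : {set T}, c p != 0 -> p \subset e3 ->
  [|| p \subset e1, p \subset e2 | p == e3].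
Proof.
case=> /and5P[s1 s2 s3 n12 /and5P[n13 n21 n23 n31 n32]] supp low F0 p cp p3.
apply/idPn; rewrite !negb_or => /and3P[n1 n2 ne3]; case/eqP: (cp).
have Ap := proper_sub (low p cp).
have n3p : ~~ (e3 \subset p) by apply: contraNN ne3 => ?; rewrite eqEsubset p3.
apply: (@sole_term_eq0 _ _ (fun q : {set T} => q :\: (e1 :&: e2) == p :\: (e1 :&: e2))) => //.
  (* If [e1 :&: e2 :|: Q] contained [e3], so would [p]; hence this set is tight. *)
  apply: fiber_sum_eq0 => Q Qp; apply: F0; last by rewrite subsetUl.
  by apply: contraNN n3p => ?; pointwise.
move=> q /eqP qp cq; have Aq := proper_sub (low q cq).
case/or3P: (supp q cq) => sq.
- by case/negP: n1; pointwise.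
- by case/negP: n2; pointwise.
- by pointwise.
Qed.

(** For [p] proper in [e1 :&: e3], the supported sets of its fibre outside [e1 :&: e2] lie in [e1],
    so [triple_tight_mixed] leaves three cases. A subset of [e2] would put [p] in the triple
    intersection, [e1] itself would give [e1 :&: e3 \subset p], and a subset of [e3] is [p]. *)
Lemma triple_tight_meet (R : nmodType) (T : finType) (e1 e2 e3 : {set T}) (c : {set T} -> R) :
  triple_tight e1 e2 e3 c -> forall p : {set T}, p \subset e1 :&: e3 -> c p = 0.
Proof.
move=> hyp; have mix := triple_tight_mixed (triple_tight_rot hyp).
case: hyp => /and5P[s1 s2 s3 n12 /and5P[n13 n21 n23 n31 n32]] supp low F0.
suff lt13 (p : {set T}) : p \subset e1 :&: e3 -> p != e1 :&: e3 -> c p = 0.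
  move=> p p13; case: (eqVneq p (e1 :&: e3)) => [->|]; last exact: lt13.
  apply: (@sole_term_eq0 _ _ (fun q : {set T} => q \subset e1 :&: e3)) => [//||q q13].
    rewrite F0 ?subxx ?orbT //; apply: contraNN n21 => ?; pointwise.
  by apply: contraNeq => /(lt13 q q13)->.
move=> p13 ne13; apply/eqP/idPn => cp.
have /andP[Ap nAp] := low p cp.
have n12p : ~~ (p \subset e1 :&: e2) by apply: contraNN nAp => ?; pointwise.
have n13p : ~~ (e1 :&: e3 \subset p) by apply: contraNN ne13 => ?; rewrite eqEsubset p13.
suff : c p = 0 by move/eqP: cp.
apply: (@sole_term_eq0 _ _ (fun q : {set T} => q :\: (e1 :&: e2) == p :\: (e1 :&: e2))) => //.
  apply: fiber_sum_eq0 => Q Qp; apply: F0; last by rewrite subsetUl.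
  by apply: contraNN n31 => ?; pointwise.
move=> q /eqP qp cq; have Aq := proper_sub (low q cq).
have q1 : q \subset e1 by case/or3P: (supp q cq) => sq; pointwise.
case/or3P: (mix q cq q1) => sq.
- by case/negP: n12p; pointwise.
- by pointwise.
- by case/negP: n13p; move/eqP: sq => sq; subst q; pointwise.
Qed.

(** Subsets of the two intersections are already eliminated, so [e1] is the sole term left in the
    sum at the tight set [e1]. *)
Lemma triple_tight_edge (R : nmodType) (T : finType) (e1 e2 e3 : {set T}) (c : {set T} -> R) :
  triple_tight e1 e2 e3 c -> forall p : {set T}, p \subset e1 -> c p = 0.
Proof.
move=> hyp; have mix := triple_tight_mixed (triple_tight_rot hyp).
have z13 := triple_tight_meet hyp; have z12 := triple_tight_meet (triple_tight_swap (triple_tight_rot (triple_tight_rot hyp))).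
case: hyp => /and5P[s1 s2 s3 n12 /and5P[n13 n21 n23 n31 n32]] supp low F0.
have eq1 (p : {set T}) : p \subset e1 -> c p != 0 -> p = e1.
  move=> p1 cp; apply/eqP/idPn => ne1; case/eqP: (cp).
  case/or3P: (mix p cp p1) => sp; last by rewrite sp in ne1.
  - by apply: z12; rewrite subsetI p1.
  - by apply: z13; rewrite subsetI p1.
move=> p p1; apply/eqP/idPn => cp; case/eqP: (cp); rewrite (eq1 p p1 cp).
apply: (@sole_term_eq0 _ _ (fun q : {set T} => q \subset e1)) => //.
by apply: F0; rewrite ?subsetIl //; apply: contraNN n21 => ?; pointwise.
Qed.

Lemma triple_tight_span (R : nmodType) (T : finType) (e1 e2 e3 : {set T}) (c : {set T} -> R) :
  triangle e1 e2 e3 ->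
  (forall p : {set T}, c p != 0 -> [|| p \subset e1, p \subset e2 | p \subset e3]) ->
  (forall S : {set T}, ~~ (e1 :&: e2 :&: e3 \subset S) ->
     \sum_(p : {set T} | p \subset S) c p = 0) ->
  (forall S : {set T}, ~~ (e1 :|: e2 :|: e3 \subset S) ->
     [|| e1 :&: e2 \subset S, e1 :&: e3 \subset S | e2 :&: e3 \subset S] ->
     \sum_(p : {set T} | p \subset S) c p = 0) ->
  \sum_(p : {set T} | p \subset e1 :&: e2 :&: e3) c p = 0 ->
  forall p : {set T}, c p = 0.
Proof.
move=> tri supp Fa Fb Fc.
have hyp : triple_tight e1 e2 e3 c.
  (* If [p] is not strictly above the triple intersection, each subset of [p] either fails to
     contain it, hence is tight, or equals it, where the sum vanishes by [Fc]. *)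
  split=> // p cp; apply/idPn; rewrite properE negb_and negbK => nAp.
  case/eqP: (cp); apply: coef_eq0 => q qp.
  case: (boolP (e1 :&: e2 :&: e3 \subset q)) => [Aq|]; last exact: Fa.
  rewrite (subset_trans Aq qp) /= in nAp.
  by rewrite (_ : q = e1 :&: e2 :&: e3) //; apply/eqP; rewrite eqEsubset Aq (subset_trans qp).
move=> p; apply/eqP/idPn => cp; case/eqP: (cp).
case/or3P: (supp p cp).
- exact: (triple_tight_edge hyp).
- exact: (triple_tight_edge (triple_tight_rot hyp)).
- exact: (triple_tight_edge (triple_tight_rot (triple_tight_rot hyp))).
Qed.

(** * Affine forms and switching at the vertices *)

Definition vertex (R : realFieldType) (T : finType) (G : hypergraph T)
  (S : {set T}) : point R G := [ffun p : coord G => (val p \subset S)%:R : R^o].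

(** The constant term is stored at [set0], in line with the convention for the empty product, so
    that evaluating at a vertex becomes a plain sum over subsets. *)
Definition coef (R : realFieldType) (T : finType) (G : hypergraph T)
    (f : aform R G) (p : {set T}) : R :=
  if p == set0 then f.2 else if insub p is Some q then f.1 q else 0.

Definition symdiff (T : finType) (A B : {set T}) : {set T} :=
  [set x | (x \in A) (+) (x \in B)].

(** Ensures that [phi] only produces the constant one or genuine coordinates, never the junk value
    of [zvar]. *)
Definition down_closed (T : finType) (G : hypergraph T) : Prop :=
  forall p q : {set T}, p \in coord_sets G -> q \subset p ->
    (q == set0) || (q \in coord_sets G).

Lemma symdiffK (T : finType) (A B : {set T}) : symdiff (symdiff A B) B = A.
Proof. by apply/setP => x; rewrite !inE addbK. Qed.

Lemma coord_neq0 (T : finType) (G : hypergraph T) (p : {set T}) :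
  p \in coord_sets G -> p != set0.
Proof.
rewrite inE => /orP[/imsetP[v _ ->]|pE]; rewrite -card_gt0 ?cards1 //.
by have /forall_inP/(_ p pE)/andP[_ /ltnW] := edgesP G.
Qed.

Lemma coord_node (T : finType) (G : hypergraph T) (e : {set T}) (v : T) :
  e \in edges G -> v \in e -> [set v] \in coord_sets G.
Proof.
move=> eE ve; rewrite inE imset_f //.
by have /forall_inP/(_ e eE)/andP[/subsetP->] := edgesP G.
Qed.

Lemma eval0 (R : realFieldType) (T : finType) (G : hypergraph T) (z : point R G) :
  eval 0 z = 0.
Proof. by rewrite -(scale0r (0 : aform R G)) evalZ mul0r. Qed.

Lemma evalN (R : realFieldType) (T : finType) (G : hypergraph T)
  (f : aform R G) (z : point R G) : eval (- f) z = - eval f z.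
Proof. by rewrite -scaleN1r evalZ mulN1r. Qed.

Lemma eval_sum (R : realFieldType) (T : finType) (G : hypergraph T)
    (I : finType) (P : pred I) (f : I -> aform R G) (z : point R G) :
  eval (\sum_(i | P i) f i) z = \sum_(i | P i) eval (f i) z.
Proof. by apply: (big_morph (fun f => eval f z)) => [g h|]; rewrite ?evalD ?eval0. Qed.

Lemma eval_affine (R : realFieldType) (T : finType) (G : hypergraph T)
    (f : aform R G) (n : nat) (c : 'I_n -> R) (x : 'I_n -> point R G) :
  \sum_i c i = 1 -> eval f (\sum_i c i *: x i) = \sum_i c i * eval f (x i).
Proof.
move=> c1; rewrite /eval.
under [RHS]eq_bigr do rewrite mulrDr.
rewrite big_split /= -mulr_suml c1 mul1r; congr (_ + _).
under [RHS]eq_bigr do rewrite mulr_sumr.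
rewrite exchange_big; apply: eq_bigr => p _ /=.
rewrite sum_ffunE mulr_sumr; apply: eq_bigr => i _.
by rewrite ffunE mulrCA.
Qed.

Lemma eval_zvar_coord (R : realFieldType) (T : finType) (G : hypergraph T)
  (q : coord G) (z : point R G) : eval (zvar R G (val q)) z = z q.
Proof.
rewrite /eval /= (negbTE (coord_neq0 (valP q))) addr0 (bigD1 q) //= ffunE eqxx mul1r.
by rewrite big1 ?addr0 // => p pq; rewrite ffunE val_eqE (negbTE pq) mul0r.
Qed.

Lemma eval_zvar_vertex (R : realFieldType) (T : finType) (G : hypergraph T)
    (p S : {set T}) :
  (p == set0) || (p \in coord_sets G) ->
  eval (zvar R G p) (vertex R G S) = (p \subset S)%:R.
Proof.
case: eqP => [-> _|_ /= pG]; last first.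
  by rewrite (eval_zvar_coord (Sub p pG : coord G)) ffunE.
rewrite /eval /= eqxx sub0set big1 ?add0r // => q _.
by rewrite ffunE (negbTE (coord_neq0 (valP q))) mul0r.
Qed.

Lemma eval_vertex (R : realFieldType) (T : finType) (G : hypergraph T)
    (f : aform R G) (S : {set T}) :
  eval f (vertex R G S) = \sum_(p : {set T} | p \subset S) coef f p.
Proof.
rewrite (bigD1 set0) ?sub0set //= {1}/coef eqxx addrC; congr (_ + _).
rewrite (bigID (fun p => p \in coord_sets G)) /= [X in _ = _ + X]big1 ?addr0; last first.
  by move=> p /andP[/andP[_ p0] pG]; rewrite /coef (negbTE p0) insubN.
rewrite (eq_bigl (fun p => (p \in coord_sets G) && (p \subset S))); last first.
  move=> p; case: (boolP (p \in _)) => [/coord_neq0->|]; rewrite ?andbF ?andbT //.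
rewrite big_mkcondr [RHS]big_sub; apply: eq_bigr => q _.
rewrite ffunE /coef (negbTE (coord_neq0 (valP q))) valK.
by case: ifP => _; rewrite ?mulr1 ?mulr0.
Qed.

(** Both sides are the product over all [x] of one minus the indicator of [x \in B], once expanded
    and once evaluated. *)
Lemma sum_sign_subset (R : comPzRingType) (T : finType) (B : {set T}) :
  \sum_(W : {set T} | W \subset B) (-1) ^+ #|W| = (B == set0)%:R :> R.
Proof.
have -> : (B == set0)%:R = \prod_(x : T) (- (x \in B)%:R + 1) :> R.
  case: (set_0Vmem B) => [->|[x xB]].
    by rewrite eqxx big1 // => x _; rewrite inE oppr0 add0r.
  rewrite (bigD1 x) //= xB addNr mul0r.
  by case: eqP xB => // ->; rewrite inE.
rewrite bigA_distr big_mkcond; apply: eq_bigr => W _.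
rewrite -big_mkcond /=; case: ifP => [/subsetP WB|/negbT/subsetPn[x xW /negbTE xB]].
  by rewrite (eq_bigr (fun=> -1)) ?prodr_const // => x /WB ->.
by rewrite (bigD1 x) //= xB oppr0 mul0r.
Qed.

(** Only [W] inside [S] contribute, so the signed sum tests whether [p], [U] and [S] have no common
    element; together with [p :\: U \subset S] this is inclusion in the symmetric difference. *)
Lemma eval_phi_vertex (R : realFieldType) (T : finType) (G : hypergraph T)
    (U S : {set T}) (p : coord G) :
  down_closed G ->
  eval (phi R U p) (vertex R G S) = (val p \subset symdiff S U)%:R.
Proof.
move=> dc.
have evalW (W : {set T}) : W \subset val p :&: U ->
    eval (zvar R G ((val p :\: U) :|: W)) (vertex R G S)
    = (val p :\: U \subset S)%:R * (W \subset S)%:R.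
  move=> Wp; rewrite eval_zvar_vertex ?subUset -?natrM ?mulnb //.
  apply: (dc (val p)); first exact: valP.
  by rewrite subUset subsetDl (subset_trans Wp) ?subsetIl.
rewrite /phi evalD evalN !eval_sum.
transitivity (\sum_(W : {set T} | W \subset val p :&: U)
    (-1) ^+ #|W| * ((val p :\: U \subset S)%:R * (W \subset S)%:R) : R).
  rewrite [RHS](bigID (fun W : {set T} => ~~ odd #|W|)) /= -sumrN; congr (_ + _).
    apply: eq_bigr => W /andP[Wp ev]; rewrite evalW //.
    by rewrite -signr_odd (negbTE ev) mul1r.
  apply: eq_big => [W|W /andP[Wp od]]; first by rewrite negbK.
  by rewrite evalW // -signr_odd od mulN1r.
transitivity ((val p :\: U \subset S)%:R
    * (\sum_(W : {set T} | W \subset val p :&: U :&: S) (-1) ^+ #|W|) : R).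
  rewrite mulr_sumr [LHS]big_mkcond [RHS]big_mkcond; apply: eq_bigr => W _.
  rewrite (subsetI W (val p :&: U) S); case: ifP => //= _.
  by case: ifP => _; rewrite ?mulr1 ?mulr0 // mulrC.
rewrite sum_sign_subset -natrM mulnb; congr (_%:R); congr nat_of_bool.
apply/andP/subsetP => [[/subsetP pS /eqP/setP pU] x xp|sub].
  have := pU x; have /implyP := pS x; rewrite !inE xp /=.
  by case: (x \in U); case: (x \in S) => //= /(_ isT).
split; first by apply/subsetP => x; rewrite inE => /andP[xU /sub]; rewrite inE (negbTE xU) addbF.
apply/eqP/setP => x; rewrite !inE; case: (boolP (x \in val p)) => //= /sub.
by rewrite inE; case: (x \in U); case: (x \in S).
Qed.

Lemma eval_subst_phi_vertex (R : realFieldType) (T : finType) (G : hypergraph T)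
    (U S : {set T}) (f : aform R G) :
  down_closed G ->
  eval (subst_phi U f) (vertex R G S) = eval f (vertex R G (symdiff S U)).
Proof.
move=> dc; rewrite eval_subst_phi; congr eval.
by apply/ffunP => p; rewrite !ffunE eval_phi_vertex.
Qed.

(** * Vertices of the multilinear polytope *)

Lemma multilinear_vertex (R : realFieldType) (T : finType) (G : hypergraph T)
  (S : {set T}) : multilinear_point (vertex R G S).
Proof.
split=> [p|e eE]; first by rewrite ffunE; case: (_ \subset _); [right|left].
rewrite eval_zvar_vertex; last by rewrite /coord_sets !inE eE !orbT.
under eq_bigr => v ve do rewrite eval_zvar_vertex ?(coord_node eE ve) ?orbT // sub1set.
case: (boolP (e \subset S)) => [/subsetP eS|/subsetPn[v ve /negbTE vS]].
  by rewrite big1 // => v /eS ->.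
by rewrite (bigD1 v) //= vS mul0r.
Qed.

Lemma multilinear_pointE (R : realFieldType) (T : finType) (G : hypergraph T)
    (z : point R G) :
  multilinear_point z -> exists S, z = vertex R G S.
Proof.
move=> [z01 zE]; pose x v := eval (zvar R G [set v]) z.
(* Elements of [T] that are not nodes read the junk value 0 and stay out of this set. *)
exists [set v | x v == 1]; apply/ffunP => q; rewrite ffunE.
have x01 v : [set v] \in coord_sets G -> x v = (x v == 1)%:R.
  move=> vG; rewrite /x (eval_zvar_coord (Sub [set v] vG : coord G)).
  by case: (z01 (Sub [set v] vG)) => ->; rewrite ?eqxx // eq_sym oner_eq0.
rewrite -eval_zvar_coord; have := valP q; rewrite {1}/coord_sets inE.
case/orP => [/imsetP[v vN qv]|qE].
  by rewrite qv sub1set inE -x01 // /coord_sets inE imset_f.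
rewrite zE //; case: (boolP (_ \subset _)) => [/subsetP sub|/subsetPn[v vq]].
  by rewrite big1 // => v /sub; rewrite inE => /eqP.
rewrite inE => xv; rewrite (bigD1 v) //= -/(x v) x01 ?(coord_node qE vq) //.
by rewrite (negbTE xv) mul0r.
Qed.

Lemma MP_vertex (R : realFieldType) (T : finType) (G : hypergraph T)
  (S : {set T}) : MP R G (vertex R G S).
Proof.
exists 1%N, (fun=> vertex R G S), (fun=> 1); split=> //.
- by move=> _; apply: multilinear_vertex.
- by rewrite big_ord1.
- by rewrite big_ord1 scale1r.
Qed.

Lemma valid_MP (R : realFieldType) (T : finType) (G : hypergraph T) (I : ineq R G) :
  (forall S, eval I.1 (vertex R G S) <= eval I.2 (vertex R G S)) ->
  valid (MP R G) I.
Proof.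
move=> le z [n [x [c [xP c0 c1 ->]]]]; rewrite !eval_affine //.
apply: ler_sum => i _; apply: ler_wpM2l => //.
by have [S ->] := multilinear_pointE (xP i).
Qed.

(** By inversion the vertices affinely span the whole space, which makes [MP] full-dimensional. *)
Lemma eval_eq0 (R : realFieldType) (T : finType) (G : hypergraph T) (f : aform R G) :
  (forall S, eval f (vertex R G S) = 0) -> f = 0.
Proof.
move=> f0; have c0 p : coef f p = 0 by apply: coef_eq0 => q _; rewrite -eval_vertex.
rewrite [f]surjective_pairing; congr (_, _).
  apply/ffunP => q; rewrite ffunE; have := c0 (val q).
  by rewrite /coef (negbTE (coord_neq0 (valP q))) valK.
by have := c0 set0; rewrite /coef eqxx.
Qed.

(** * Dimension as matrix rank, and the facet criterion *)

(** Homogenisation: the extra column of ones turns affine independence of points into linear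
    independence of rows. *)
Definition homog_mx (R : realFieldType) (T : finType) (G : hypergraph T)
    (n : nat) (x : 'I_n -> point R G) : 'M[R]_(n, #|{: coord G}| + 1) :=
  row_mx (\matrix_(i, j) x i (enum_val j)) (const_mx 1).

Definition aform_col (R : realFieldType) (T : finType) (G : hypergraph T)
    (f : aform R G) : 'cV[R]_(#|{: coord G}| + 1) :=
  col_mx (\col_j f.1 (enum_val j)) (const_mx f.2).

Lemma homog_mx_mul (R : realFieldType) (T : finType) (G : hypergraph T)
    (n : nat) (x : 'I_n -> point R G) (f : aform R G) :
  homog_mx x *m aform_col f = \col_i eval f (x i).
Proof.
apply/colP => i; rewrite mul_row_col !mxE big_ord1 !mxE mul1r; congr (_ + _).
rewrite (big_enum_val (fun p => f.1 p * x i p)) /=.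
by apply: eq_bigr => j _; rewrite !mxE mulrC.
Qed.

Lemma aform_col_surj (R : realFieldType) (T : finType) (G : hypergraph T)
  (v : 'cV[R]_(#|{: coord G}| + 1)) : exists f : aform R G, aform_col f = v.
Proof.
exists ([ffun p => usubmx v (enum_rank p) 0], dsubmx v 0 0).
rewrite -[RHS]vsubmxK; congr col_mx; apply/colP => j; rewrite mxE ?ord1 //.
by rewrite ffunE enum_valK.
Qed.

Lemma affinely_independentP (R : realFieldType) (T : finType) (G : hypergraph T)
    (n : nat) (x : 'I_n -> point R G) :
  affinely_independent x <-> row_free (homog_mx x).
Proof.
have mulE (c : 'I_n -> R) : (\row_i c i) *m homog_mx x
    = row_mx (\row_j (\sum_i c i *: x i) (enum_val j)) (const_mx (\sum_i c i)).
  rewrite mul_mx_row; congr row_mx; apply/rowP => j; rewrite !mxE.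
    by rewrite sum_ffunE; apply: eq_bigr => i _; rewrite !mxE ffunE.
  by apply: eq_bigr => i _; rewrite !mxE mulr1.
split=> [indep|/row_free_inj inj c c0 cx].
  apply: inj_row_free => v v0; apply/rowP => i; rewrite mxE.
  have vE : v = \row_i v 0 i by apply/rowP => j; rewrite mxE.
  have : (\row_i v 0 i) *m homog_mx x = row_mx 0 0 by rewrite -vE v0 row_mx0.
  rewrite mulE => /eq_row_mx[/rowP vx /rowP vc].
  apply: (indep (v 0)); first by have := vc 0; rewrite !mxE.
  by apply/ffunP => p; have := vx (enum_rank p); rewrite !mxE enum_rankK ffunE.
have /inj/rowP cE : (\row_i c i) *m homog_mx x = 0 *m homog_mx x.
  rewrite mulE c0 cx mul0mx -row_mx0; congr row_mx; apply/rowP => j.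
  by rewrite !mxE ffunE.
by move=> i; have := cE i; rewrite !mxE.
Qed.

(** The two bounds fix the rank of [homog_mx x], and [maxrankfun] selects that many independent
    rows, that is, points of [P]. *)
Lemma has_dim_rank (R : realFieldType) (T : finType) (G : hypergraph T)
    (P : point R G -> Prop) (d m : nat) (x : 'I_m -> point R G) :
  (forall i, P (x i)) -> (d.+1 <= \rank (homog_mx x))%N ->
  (forall n (y : 'I_n -> point R G), (forall i, P (y i)) ->
     (\rank (homog_mx y) <= d.+1)%N) ->
  has_dim P d.
Proof.
move=> Px ge le; split=> [|n y Py /affinely_independentP]; last first.
  by rewrite /row_free => /eqP <-; apply: le.
have /eqP <- : \rank (homog_mx x) == d.+1 by rewrite eqn_leq le.
exists (x \o maxrankfun (homog_mx x)); split=> [i|]; first exact: Px.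
apply/affinely_independentP; have := maxrowsub_free (homog_mx x).
congr row_free; apply/matrixP => i j; rewrite !mxE.
by case: split => k; rewrite !mxE.
Qed.

Lemma homog_mx_full (R : realFieldType) (T : finType) (G : hypergraph T)
    (m : nat) (A : 'M[R]_(m, #|{: coord G}| + 1)) :
  (forall f : aform R G, A *m aform_col f = 0 -> f = 0) ->
  \rank A = (#|{: coord G}| + 1)%N.
Proof.
move=> inj; rewrite -mxrank_tr; apply/eqP; apply: inj_row_free => v.
move=> /(congr1 trmx); rewrite trmx_mul trmxK trmx0.
have [f fE] := aform_col_surj v^T; rewrite -fE => /inj f0.
rewrite -[v]trmxK -fE f0; apply/rowP => j; rewrite !mxE.
by case: split => k; rewrite !mxE ?ffunE.
Qed.

Lemma defines_facet_vertices (R : realFieldType) (T : finType) (G : hypergraph T)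
    (p0 : coord G) (I : ineq R G) (S0 : {set T}) :
  (forall S, eval I.1 (vertex R G S) <= eval I.2 (vertex R G S)) ->
  eval I.1 (vertex R G S0) != eval I.2 (vertex R G S0) ->
  (forall f : aform R G,
     (forall S, eval I.1 (vertex R G S) = eval I.2 (vertex R G S) ->
        eval f (vertex R G S) = 0) ->
     eval f (vertex R G S0) = 0 ->
     forall S, eval f (vertex R G S) = 0) ->
  defines_facet (MP R G) I.
Proof.
move=> le neq0 span; split; first exact: valid_MP.
(* The coordinate [p0] makes the ambient dimension positive, so the facet dimension [d] exists as a
   natural number. *)
have [d dE] : exists d, #|{: coord G}| = d.+1.
  by exists #|{: coord G}|.-1; rewrite prednK //; apply/card_gt0P; exists p0.
exists d; split.
  apply: (@has_dim_rank _ _ _ _ _ _ (fun i : 'I_#|{set T}| => vertex R G (enum_val i))).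
  - by move=> i; apply: MP_vertex.
  - rewrite homog_mx_full -?dE ?addn1 // => f; rewrite homog_mx_mul => /colP f0.
    apply: eval_eq0 => S; have := f0 (enum_rank S).
    by rewrite !mxE enum_rankK.
  - by move=> n y _; apply: leq_trans (rank_leq_col _) _; rewrite dE addn1.
pose P := [set S | eval I.1 (vertex R G S) == eval I.2 (vertex R G S)].
pose x (i : 'I_#|P|) := vertex R G (enum_val i).
apply: (@has_dim_rank _ _ _ _ _ _ x).
- move=> i; split; first exact: MP_vertex.
  by apply/eqP; have := enum_valP i; rewrite inE.
(* With the row of [S0] added the tight vertices have full rank, and one row raises the rank by at
   most one. *)
- have : \rank (col_mx (homog_mx x) (homog_mx (fun _ : 'I_1 => vertex R G S0)))
      = (d.+1 + 1)%N.
    rewrite -dE; apply: homog_mx_full => f; rewrite mul_col_mx !homog_mx_mul.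
    rewrite -(@col_mx0 R #|P| 1 1) => /eq_col_mx[/colP fx /colP f0].
    apply: eval_eq0; apply: span => [S /eqP tS|]; last first.
      by have := f0 0; rewrite !mxE.
    have SP : S \in P by rewrite inE.
    by have := fx (enum_rank_in SP S); rewrite !mxE /x enum_rankK_in.
  rewrite -addsmxE => rk; rewrite -(leq_add2r 1) -rk.
  apply: leq_trans (mxrank_adds_leqif _ _) _.
  by rewrite leq_add2l rank_leq_row.
- move=> n y Py; rewrite -(leq_add2r 1) -[X in (_ <= X + 1)%N]dE.
  (* The column of [I.1 - I.2] annihilates every family in the face and is nonzero because [S0] is
     not tight, so the rank drops by at least one. *)
  have /mulmx0_rank_max : homog_mx y *m aform_col (I.1 - I.2) = 0.
    apply/colP => i; rewrite homog_mx_mul !mxE evalD evalN.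
    by have [_ ->] := Py i; rewrite subrr.
  apply: leq_trans; rewrite leq_add2l lt0n mxrank_eq0.
  apply: contraNneq neq0 => w0; rewrite -subr_eq0 -evalN -evalD.
  have := homog_mx_mul (fun _ : 'I_1 => vertex R G S0) (I.1 - I.2).
  by rewrite w0 mulmx0 => /colP/(_ 0); rewrite !mxE => <-.
Qed.

(** Symmetric difference with [U] is an involution on the vertices, so the criterion carries over
    with [symdiff S0 U] for [S0] and [subst_phi U f] for [f]. *)
Lemma switching_facet (R : realFieldType) (T : finType) (G : hypergraph T)
    (p0 : coord G) (U : {set T}) (I : ineq R G) (S0 : {set T}) :
  down_closed G ->
  (forall S, eval I.1 (vertex R G S) <= eval I.2 (vertex R G S)) ->
  eval I.1 (vertex R G S0) != eval I.2 (vertex R G S0) ->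
  (forall f : aform R G,
     (forall S, eval I.1 (vertex R G S) = eval I.2 (vertex R G S) ->
        eval f (vertex R G S) = 0) ->
     eval f (vertex R G S0) = 0 ->
     forall p : {set T}, coef f p = 0) ->
  defines_facet (MP R G) (switching U I).
Proof.
move=> dc le neq0 span.
apply: (@defines_facet_vertices _ _ _ p0 _ (symdiff S0 U)).
- by move=> S; rewrite !eval_subst_phi_vertex.
- by rewrite !eval_subst_phi_vertex // symdiffK.
- move=> f ft f0 S; rewrite -(symdiffK S U) -eval_subst_phi_vertex //.
  rewrite eval_vertex big1 // => p _; apply: span => [S' tS'|].
    by rewrite eval_subst_phi_vertex //; apply: ft; rewrite !eval_subst_phi_vertex // symdiffK.
  by rewrite eval_subst_phi_vertex.
Qed.

(** * The four inequalities at the vertices *)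

Definition in_cycle3 (T : finType) (G : hypergraph T) (e1 e2 e3 : {set T}) :=
  [/\ triangle e1 e2 e3, down_closed G, e1 \in coord_sets G, e2 \in coord_sets G
    & e3 \in coord_sets G].

Lemma eval_zvar_sub (R : realFieldType) (T : finType) (G : hypergraph T)
    (e p S : {set T}) :
  down_closed G -> e \in coord_sets G -> p \subset e ->
  eval (zvar R G p) (vertex R G S) = (p \subset S)%:R.
Proof. by move=> dc eG pe; apply: eval_zvar_vertex; apply: (dc e). Qed.

(** A covered edge is the union of its two pairwise intersections. Validity and tightness thus
    become case checks on which intersections lie in [S]. *)
Lemma triangle_subsets (T : finType) (e1 e2 e3 S : {set T}) :
  triangle e1 e2 e3 ->
  [/\ (e1 \subset S) = (e1 :&: e2 \subset S) && (e1 :&: e3 \subset S),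
      (e2 \subset S) = (e1 :&: e2 \subset S) && (e2 :&: e3 \subset S),
      (e3 \subset S) = (e1 :&: e3 \subset S) && (e2 :&: e3 \subset S)
    & [|| e1 :&: e2 \subset S, e1 :&: e3 \subset S | e2 :&: e3 \subset S] ->
      e1 :&: e2 :&: e3 \subset S].
Proof.
case/and5P=> s1 s2 s3 _ _; split.
- by apply/idP/andP => [?|[? ?]]; [split|]; pointwise.
- by apply/idP/andP => [?|[? ?]]; [split|]; pointwise.
- by apply/idP/andP => [?|[? ?]]; [split|]; pointwise.
- by case/or3P => ?; pointwise.
Qed.

Lemma eval_pair_ineq (R : realFieldType) (T : finType) (G : hypergraph T)
    (e1 e2 e3 S : {set T}) :
  in_cycle3 G e1 e2 e3 ->
  eval (zvar R G e1 + zvar R G e2) (vertex R G S)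
    = ((e1 \subset S) + (e2 \subset S))%:R /\
  eval (zvar R G (e1 :&: e2) + zvar R G e3) (vertex R G S)
    = ((e1 :&: e2 \subset S) + (e3 \subset S))%:R.
Proof.
case=> tri dc c1 c2 c3; rewrite !evalD !natrD; split.
  by rewrite (eval_zvar_sub _ _ dc c1) // (eval_zvar_sub _ _ dc c2).
by rewrite (eval_zvar_sub _ _ dc c1) ?subsetIl // (eval_zvar_sub _ _ dc c3).
Qed.

Lemma pair_ineq_le (R : realFieldType) (T : finType) (G : hypergraph T)
    (e1 e2 e3 S : {set T}) :
  in_cycle3 G e1 e2 e3 ->
  eval (zvar R G e1 + zvar R G e2) (vertex R G S)
    <= eval (zvar R G (e1 :&: e2) + zvar R G e3) (vertex R G S).
Proof.
move=> cyc; have [-> ->] := eval_pair_ineq R S cyc; rewrite ler_nat.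
case: cyc => /(triangle_subsets S)[-> -> -> _] _ _ _ _.
(* With booleans a, b, c for [e1 :&: e2], [e1 :&: e3], [e2 :&: e3] lying in [S], this is ab + ac <=
   a + bc. *)
by do 3! case: (_ \subset S).
Qed.

Lemma coef_supp (R : realFieldType) (T : finType) (G : hypergraph T)
  (f : aform R G) (p : {set T}) :
  coef f p != 0 -> (p == set0) || (p \in coord_sets G).
Proof.
rewrite /coef; case: (p == set0) => //=.
by case: (boolP (p \in _)) => // pG; rewrite insubN ?eqxx.
Qed.

Lemma pair_ineq_facet (R : realFieldType) (T : finType) (G : hypergraph T)
    (e1 e2 e3 U : {set T}) :
  in_cycle3 G e1 e2 e3 ->
  (forall p, p \in coord_sets G -> [|| p \subset e1, p \subset e2 | p \subset e3]) ->
  defines_facet (MP R G) (switching U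
    (zvar R G e1 + zvar R G e2, zvar R G (e1 :&: e2) + zvar R G e3)).
Proof.
move=> cyc supp; have [tri dc c1 c2 c3] := cyc.
have /and5P[s1 s2 s3 n12 /and5P[n13 n21 n23 n31 n32]] := tri.
apply: (@switching_facet _ _ _ (Sub e1 c1 : coord G) U _ (e1 :&: e2)) => //=.
- by move=> S; apply: pair_ineq_le.
- have [-> ->] := eval_pair_ineq R (e1 :&: e2) cyc; rewrite eqr_nat subxx !subsetI.
  by rewrite (negbTE n12) (negbTE n21) (negbTE n31) !andbF.
move=> f ft f0; apply: (pair_tight_span tri).
- move=> p /coef_supp/orP[/eqP->|]; [by rewrite sub0set|exact: supp].
- move=> S n12S n3S; rewrite -eval_vertex; apply: ft.
  have [-> ->] := eval_pair_ineq R S cyc; rewrite (negbTE n12S) (negbTE n3S).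
  by have [-> -> _ _] := triangle_subsets S tri; rewrite (negbTE n12S).
- move=> S eS; rewrite -eval_vertex; apply: ft.
  have [-> ->] := eval_pair_ineq R S cyc; move: eS.
  have [-> -> -> _] := triangle_subsets S tri.
  by do 3! case: (_ \subset S).
- by rewrite -eval_vertex.
Qed.

Definition triple_ineq (R : realFieldType) (T : finType) (G : hypergraph T)
    (e1 e2 e3 : {set T}) : ineq R G :=
  let z := zvar R G in
  (z (e1 :&: e2) + z (e1 :&: e3) + z (e2 :&: e3) - z e1 - z e2 - z e3,
   z (e1 :&: e2 :&: e3)).

Lemma eval_triple_ineq (R : realFieldType) (T : finType) (G : hypergraph T)
    (e1 e2 e3 S : {set T}) (I := triple_ineq R G e1 e2 e3) :
  in_cycle3 G e1 e2 e3 ->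
  eval I.1 (vertex R G S)
    = ((e1 :&: e2 \subset S) + (e1 :&: e3 \subset S) + (e2 :&: e3 \subset S))%:R
      - ((e1 \subset S) + (e2 \subset S) + (e3 \subset S))%:R /\
  eval I.2 (vertex R G S) = (e1 :&: e2 :&: e3 \subset S)%:R.
Proof.
case=> tri dc c1 c2 c3; rewrite /= !evalD !evalN.
have z1 p := @eval_zvar_sub R T G e1 p S dc c1.
have z2 p := @eval_zvar_sub R T G e2 p S dc c2.
have z3 p := @eval_zvar_sub R T G e3 p S dc c3.
rewrite (z1 (e1 :&: e2)) ?subsetIl // (z1 (e1 :&: e3)) ?subsetIl //.
rewrite (z2 (e2 :&: e3)) ?subsetIl // (z1 e1) // (z2 e2) // (z3 e3) //.
by rewrite (z3 (e1 :&: e2 :&: e3)) ?subsetIr // !natrD !opprD !addrA.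
Qed.

Lemma triple_ineq_le (R : realFieldType) (T : finType) (G : hypergraph T)
    (e1 e2 e3 S : {set T}) (I := triple_ineq R G e1 e2 e3) :
  in_cycle3 G e1 e2 e3 -> eval I.1 (vertex R G S) <= eval I.2 (vertex R G S).
Proof.
move=> cyc; have [-> ->] := eval_triple_ineq R S cyc; rewrite lerBlDr -natrD ler_nat.
case: cyc => /(triangle_subsets S)[-> -> -> +] _ _ _ _.
(* This is a + b + c <= t + ab + ac + bc, where t stands for the triple intersection and is forced
   by any of a, b, c. *)
by case: (e1 :&: e2 :&: e3 \subset S); do 3! case: (_ \subset S); move=> //= A; have := A isT.
Qed.

Lemma triple_ineq_facet (R : realFieldType) (T : finType) (G : hypergraph T)
    (e1 e2 e3 U : {set T}) :
  in_cycle3 G e1 e2 e3 ->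
  (forall p, p \in coord_sets G -> [|| p \subset e1, p \subset e2 | p \subset e3]) ->
  defines_facet (MP R G) (switching U (triple_ineq R G e1 e2 e3)).
Proof.
move=> cyc supp; have [tri dc c1 c2 c3] := cyc.
have /and5P[s1 s2 s3 n12 /and5P[n13 n21 n23 n31 n32]] := tri.
(* Once the triple intersection is in [S], tightness fails exactly when none or all of the pairwise
   intersections are in [S]. *)
have tightE S : (eval (triple_ineq R G e1 e2 e3).1 (vertex R G S)
     == eval (triple_ineq R G e1 e2 e3).2 (vertex R G S))
   = (~~ (e1 :&: e2 :&: e3 \subset S)
      || [|| e1 :&: e2 \subset S, e1 :&: e3 \subset S | e2 :&: e3 \subset S]
         && ~~ (e1 :|: e2 :|: e3 \subset S)).
  have [-> ->] := eval_triple_ineq R S cyc; rewrite subr_eq -natrD eqr_nat !subUset.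
  have [-> -> -> A] := triangle_subsets S tri; move: A.
  by case: (e1 :&: e2 :&: e3 \subset S); do 3! case: (_ \subset S); move=> //= A; have := A isT.
apply: (@switching_facet _ _ _ (Sub e1 c1 : coord G) U (triple_ineq R G e1 e2 e3) (e1 :&: e2 :&: e3)) => //.
- by move=> S; exact: (triple_ineq_le R S cyc).
- rewrite tightE subxx /= negb_and; apply/orP; left; rewrite !negb_or.
  apply/and3P; split.
  + by apply: contraNN n13 => ?; pointwise.
  + by apply: contraNN n12 => ?; pointwise.
  + by apply: contraNN n21 => ?; pointwise.
move=> f ft f0; apply: (triple_tight_span tri).
- move=> p /coef_supp/orP[/eqP->|]; [by rewrite sub0set|exact: supp].
- by move=> S nS; rewrite -eval_vertex; apply: ft; apply/eqP; rewrite tightE nS.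
- move=> S nS eS; rewrite -eval_vertex; apply: ft; apply/eqP.
  by rewrite tightE eS nS orbT.
- by rewrite -eval_vertex.
Qed.

(** * Symmetry, and application to [G] and the support hypergraph *)

Lemma in_cycle3_swap (T : finType) (G : hypergraph T) (e1 e2 e3 : {set T}) :
  in_cycle3 G e1 e2 e3 -> in_cycle3 G e1 e3 e2.
Proof. by case=> /triangle_rot/triangle_rot/triangle_swap. Qed.

Lemma in_cycle3_rot (T : finType) (G : hypergraph T) (e1 e2 e3 : {set T}) :
  in_cycle3 G e1 e2 e3 -> in_cycle3 G e2 e3 e1.
Proof. by case=> /triangle_rot. Qed.

Lemma down_closed_cl (T : finType) (G : hypergraph T) : G = cl G -> down_closed G.
Proof.
move=> GE p q pG qp; case: (eqVneq q set0) => //= q0.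
move: pG; rewrite {1}/coord_sets inE => /orP[/imsetP[v vG pv]|pE].
  move: qp; rewrite pv subset1 (negbTE q0) orbF => /eqP ->.
  by rewrite /coord_sets inE imset_f.
have [/cards1P[v qv]|q1] := boolP (#|q| == 1)%N.
  by rewrite qv (coord_node pE) // -sub1set -qv.
rewrite inE {2}GE /= inE; apply/orP; right; apply/andP; split.
  by rewrite ltn_neqAle eq_sym q1 card_gt0.
by apply/exists_inP; exists p.
Qed.

Lemma coord_sets_support (T : finType) (e1 e2 e3 p : {set T}) :
  (p \in coord_sets (support_hypergraph e1 e2 e3))
  = (p != set0) && [|| p \subset e1, p \subset e2 | p \subset e3].
Proof.
apply/idP/andP => [pG|[p0 sub]].
  split; first exact: coord_neq0 pG.
  move: pG; rewrite inE => /orP[/imsetP[v /= vN ->]|]; last first.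
    by rewrite inE => /andP[].
  by rewrite !sub1set orbA -!in_setU.
have [/cards1P[v pv]|p1] := boolP (#|p| == 1)%N.
  rewrite inE pv imset_f //= !in_setU -orbA.
  by move: sub; rewrite pv !sub1set.
by rewrite !inE sub andbT orbC ltn_neqAle eq_sym p1 card_gt0 p0.
Qed.

Theorem proposition7 (R : realFieldType) (T : finType) (G : hypergraph T)
  (e1 e2 e3 : {set T}) (HG : G = cl G)
  (HC : alpha_cycle G [tuple e1; e2; e3])
  (H1 : e1 :\: (e2 :|: e3) = set0)
  (H2 : e2 :\: (e1 :|: e3) = set0)
  (H3 : e3 :\: (e1 :|: e2) = set0) :
  (forall (U : {set T}) (I : ineq R G),
     U \subset nodes G -> I \in cycle3_ineqs R G e1 e2 e3 ->
     valid (MP R G) (switching U I)) /\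
  (let GC := support_hypergraph e1 e2 e3 in
   forall (U : {set T}) (I : ineq R GC),
     U \subset nodes GC -> I \in cycle3_ineqs R GC e1 e2 e3 ->
     defines_facet (MP R GC) (switching U I)).
Proof.
have [_ edge diff _] := HC.
have tri : triangle e1 e2 e3.
  rewrite /triangle -!setD_eq0 H1 H2 H3 !eqxx /=.
  (* List indices let all six non-inclusions come from the single cycle condition [diff]. *)
  have dif i j : (i < 3)%N -> (j < 3)%N -> i != j ->
      nth e1 [:: e1; e2; e3] i :\: nth e1 [:: e1; e2; e3] j != set0.
    move=> i3 j3 ij; have := diff (Ordinal i3) (Ordinal j3).
    by rewrite !(tnth_nth e1) /=; apply.
  by rewrite (dif 0 1)%N // (dif 0 2)%N // (dif 1 0)%N // (dif 1 2)%N // (dif 2 0)%N // (dif 2 1)%N.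
have coordE e : e \in [tuple e1; e2; e3] -> e \in coord_sets G.
  by move=> /tnthP[i ->]; rewrite /coord_sets inE edge orbT.
have cyc : in_cycle3 G e1 e2 e3.
  by split; rewrite ?coordE ?inE ?eqxx ?orbT //; apply: down_closed_cl.
split=> [U I _ inI|GC U I _ inI].
  have dc := down_closed_cl HG.
  apply: valid_MP => S; rewrite !eval_subst_phi_vertex //.
  move: inI; rewrite !inE => /or4P[] /eqP ->.
  - exact: pair_ineq_le.
  (* The second and third inequalities are the first after exchanging [e2] and [e3], respectively
     after a cyclic shift. *)
  - exact: pair_ineq_le (in_cycle3_swap cyc).
  - exact: pair_ineq_le (in_cycle3_rot cyc).
  - exact: (triple_ineq_le R _ cyc).
have supp p : p \in coord_sets GC -> [|| p \subset e1, p \subset e2 | p \subset e3].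
  by rewrite coord_sets_support => /andP[].
have cycC : in_cycle3 GC e1 e2 e3.
  have [_ _ /coord_neq0 c1 /coord_neq0 c2 /coord_neq0 c3] := cyc.
  split=> //; rewrite ?coord_sets_support ?subxx ?orbT ?andbT //.
  move=> p q; rewrite !coord_sets_support => /andP[_ sub] qp.
  case: (q == set0) => //=.
  by case/or3P: sub => /(subset_trans qp) ->; rewrite ?orbT.
move: inI; rewrite !inE => /or4P[] /eqP ->.
- exact: pair_ineq_facet.
- by apply: pair_ineq_facet (in_cycle3_swap cycC) _ => p /supp; rewrite [X in _ || X]orbC.
- by apply: pair_ineq_facet (in_cycle3_rot cycC) _ => p /supp; rewrite orbC -orbA.
- exact: triple_ineq_facet.
Qed.
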